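(* Let $F_5,\dots,F_8$ be linear forms in $x,y,z,t$ over $\mathbb{C}$ such that the planes $x=0$, $y=0$, $z=0$, $t=0$, $F_5=0,\dots,F_8=0$ in $\mathbb{P}^3$ form an octic arrangement. Then the double octic $$u^{2} = xyzt\,F_{5}(x,y,z,t)\cdots F_{8}(x,y,z,t)$$ is birational to the double quadrics fibration $$u^{2} = \lambda\, F_{5}(p_{0}q_{0}, p_{0}q_{1}, p_{1}q_{0}, \lambda p_{1}q_{1}) \cdots F_{8}(p_{0}q_{0}, p_{0}q_{1}, p_{1}q_{0}, \lambda p_{1}q_{1}),$$ where $\lambda$ is the coordinate on the base $\mathbb{P}^1$ and $\bigl((p_0:p_1),(q_0:q_1)\bigr)$ are coordinates on $\mathbb{P}^1\times\mathbb{P}^1$.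
   Context: An octic arrangement is a union $D=P_1\cup\dots\cup P_8$ of eight distinct planes in $\mathbb{P}^3=\mathbb{P}^3_{\mathbb{C}}$ such that no six of the planes meet in a point and no four contain a common line. If $P_i$ has equation $\ell_i(x,y,z,t)=0$, the double octic defined by $D$ is a Calabi–Yau threefold obtained as a crepant resolution of the double cover of $\mathbb{P}^3$ branched along $D$, i.e. of the hypersurface $u^2=\ell_1\cdots \ell_8$ in the weighted projective space $\mathbb{P}(1,1,1,1,4)$; for birational questions it can be replaced by this hypersurface. A double quadrics fibration is a family over $\mathbb{P}^1$ whose general member is a double cover of a quadric $\mathbb{P}^1\times\mathbb{P}^1$ branched along a curve of bidegree $(4,4)$ (here the union of the four curves of bidegree $(1,1)$ given by the $F_m$). *)

(* Defs.v *)
From mathcomp Require Import all_boot all_order all_algebra.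
From mathcomp Require Import reals.
From mathcomp Require Import complex.
From mathcomp Require Import mpoly.

Set Implicit Arguments.
Unset Strict Implicit.
Unset Printing Implicit Defensive.

Import GRing.Theory.
Local Open Scope ring_scope.

(* Varieties in homogeneous coordinates with respect to a torus of rank k: its
   j-th factor acts on the i-th coordinate with weight mg_wt i j.  For each
   block in mg_blocks the coordinates listed there may not vanish
   simultaneously.  A (weighted) projective space has k = 1 and one block; a
   line bundle over (P^1)^3 has k = 3 and three blocks of two coordinates. *)
Record mgvar (K : fieldType) := MgVar {
  mg_n : nat;
  mg_k : nat;
  mg_wt : 'I_mg_n -> 'I_mg_k -> nat;
  mg_blocks : seq (seq 'I_mg_n);
  mg_eqs : seq {mpoly K[mg_n]} }.

(* Vectors of homogeneous coordinates; the points of X are the classes for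
   same_pt of the vectors satisfying mem_pt.  Subsets of X are represented by
   torus-stable predicates on coordinate vectors, functions on X by
   torus-invariant functions of the coordinates. *)
Definition coords (K : fieldType) (X : mgvar K) : Type := 'I_(mg_n X) -> K.

Definition mem_pt (K : fieldType) (X : mgvar K) (v : coords X) : bool :=
  all (has (fun i => v i != 0)) (mg_blocks X)
  && all (fun p : {mpoly K[mg_n X]} => p.@[v] == 0) (mg_eqs X).

Definition same_pt (K : fieldType) (X : mgvar K) (v w : coords X) : Prop :=
  exists s : 'I_(mg_k X) -> K,
    (forall j, s j != 0)
    /\ (forall i, w i = (\prod_j s j ^+ mg_wt i j) * v i).

Definition mghomog (K : fieldType) (X : mgvar K) (d : 'I_(mg_k X) -> nat)
    (p : {mpoly K[mg_n X]}) : Prop :=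
  forall m, m \in msupp p -> forall j, (\sum_i m i * mg_wt i j)%N = d j.

(* Zariski topology: the sets where a multihomogeneous polynomial does not
   vanish form a basis. *)
Definition zopen (K : fieldType) (X : mgvar K) (U : coords X -> Prop) : Prop :=
  forall v, U v -> mem_pt v /\
    exists d (g : {mpoly K[mg_n X]}),
      [/\ mghomog d g, g.@[v] != 0
        & forall w : coords X, mem_pt w -> g.@[w] != 0 -> U w].

Definition zdense (K : fieldType) (X : mgvar K) (U : coords X -> Prop) : Prop :=
  forall W : coords X -> Prop,
    zopen W -> (exists v, W v) -> exists v, W v /\ U v.

(* Regular functions: locally a quotient of two multihomogeneous polynomials of
   the same multidegree. *)
Definition regular (K : fieldType) (X : mgvar K) (U : coords X -> Prop)
    (f : coords X -> K) : Prop :=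
  forall v, U v -> exists W : coords X -> Prop,
    [/\ zopen W, W v, (forall w, W w -> U w)
      & exists d (a b : {mpoly K[mg_n X]}),
          [/\ mghomog d a, mghomog d b
            & forall w : coords X, W w ->
                b.@[w] != 0 /\ f w = a.@[w] / b.@[w]]].

Definition morphism (K : fieldType) (X Y : mgvar K)
    (U : coords X -> Prop) (V : coords Y -> Prop)
    (phi : coords X -> coords Y) : Prop :=
  [/\ forall v, U v -> V (phi v),
      forall v w, U v -> U w -> same_pt v w -> same_pt (phi v) (phi w),
      forall W : coords Y -> Prop, zopen W ->
        zopen (fun v => U v /\ W (phi v))
    & forall (W : coords Y -> Prop) (f : coords Y -> K),
        zopen W -> (forall w, W w -> V w) -> regular W f ->
        regular (fun v => U v /\ W (phi v)) (fun v => f (phi v))].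

Definition isomorphic (K : fieldType) (X Y : mgvar K)
    (U : coords X -> Prop) (V : coords Y -> Prop) : Prop :=
  exists (phi : coords X -> coords Y) (psi : coords Y -> coords X),
    [/\ morphism U V phi, morphism V U psi,
        forall v, U v -> same_pt v (psi (phi v))
      & forall w, V w -> same_pt w (phi (psi w))].

Definition birational (K : fieldType) (X Y : mgvar K) : Prop :=
  exists (U : coords X -> Prop) (V : coords Y -> Prop),
    [/\ zopen U, zdense U, zopen V, zdense V & isomorphic U V].

(* The linear form with coefficients a, evaluated in any K-module: at a vector
   of scalars (A := K^o), or at four polynomials. *)
Definition lform (K : fieldType) (A : lmodType K) (a : 'rV[K]_4)
    (v : 'I_4 -> A) : A := \sum_(i < 4) a 0 i *: v i.

Definition on_plane (K : fieldType) (a v : 'rV[K]_4) : bool :=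
  lform (A := K^o) a (v 0) == 0.

(* Eight distinct planes in P^3, no six of them through a common point and no
   four of them through a common line.  A line is spanned by two distinct
   points, i.e. by the rows of a 2 x 4 matrix of rank 2. *)
Definition octic_arrangement (K : fieldType) (l : 'I_8 -> 'rV[K]_4) : Prop :=
  [/\ forall i, l i != 0,
      forall i j, i != j -> exists v, on_plane (l i) v != on_plane (l j) v,
      forall v : 'rV[K]_4, v != 0 -> (#|[set i | on_plane (l i) v]| < 6)%N
    & forall L : 'M[K]_(2, 4), \rank L = 2 ->
        (#|[set i | [forall r, on_plane (l i) (row r L)]]| < 4)%N].

(* The planes x = 0, y = 0, z = 0, t = 0, F_5 = 0, ..., F_8 = 0. *)
Definition octic_planes (K : fieldType) (F : 'I_4 -> 'rV[K]_4)
    (i : 'I_8) : 'rV[K]_4 :=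
  match split (i : 'I_(4 + 4)) with
  | inl j => delta_mx 0 j
  | inr j => F j
  end.

(* The hypersurface u^2 = l_1 ... l_8 in P(1,1,1,1,4), with coordinates
   x, y, z, t, u numbered from 0 to 4. *)
Definition double_octic_eqn (K : fieldType) (l : 'I_8 -> 'rV[K]_4) :
    {mpoly K[4 + 1]} :=
  'X_(rshift 4 ord0) ^+ 2 - \prod_(i < 8) lform (l i) (fun j => 'X_(lshift 1 j)).

Definition double_octic (K : fieldType) (l : 'I_8 -> 'rV[K]_4) : mgvar K :=
  {| mg_n := 4 + 1;
     mg_k := 1;
     mg_wt := fun i _ => nth 0 [:: 1; 1; 1; 1; 4]%N i;
     mg_blocks := [:: enum 'I_(4 + 1)];
     mg_eqs := [:: double_octic_eqn l] |}.

(* Coordinates (l0 : l1), (p0 : p1), (q0 : q1), u. *)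
Notation fib_l0 := (@Ordinal 7 0 isT).
Notation fib_l1 := (@Ordinal 7 1 isT).
Notation fib_p0 := (@Ordinal 7 2 isT).
Notation fib_p1 := (@Ordinal 7 3 isT).
Notation fib_q0 := (@Ordinal 7 4 isT).
Notation fib_q1 := (@Ordinal 7 5 isT).
Notation fib_u := (@Ordinal 7 6 isT).

(* (p0 q0, p0 q1, p1 q0, lambda p1 q1) with lambda = l1 / l0, homogenized. *)
Definition quadric_coords (K : fieldType) (j : 'I_4) : {mpoly K[7]} :=
  nth 0 [:: 'X_fib_l0 * 'X_fib_p0 * 'X_fib_q0;
            'X_fib_l0 * 'X_fib_p0 * 'X_fib_q1;
            'X_fib_l0 * 'X_fib_p1 * 'X_fib_q0;
            'X_fib_l1 * 'X_fib_p1 * 'X_fib_q1] j.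

(* u^2 = lambda F_5(...) ... F_8(...) has degree at most 5 in lambda, so over the whole
   base P^1 it is homogenized in degree 6: on the chart l0 = 1, lambda = l1, it
   is the affine equation (double_quadrics_eqn_chart below). *)
Definition double_quadrics_eqn (K : fieldType) (F : 'I_4 -> 'rV[K]_4) :
    {mpoly K[7]} :=
  'X_fib_u ^+ 2
  - 'X_fib_l0 * 'X_fib_l1 * \prod_(m < 4) lform (F m) (@quadric_coords K).

(* The total space of the fibration over P^1 with coordinate (l0 : l1), inside
   the line bundle O(3,2,2) over P^1 x (P^1 x P^1). *)
Definition double_quadrics_fibration (K : fieldType) (F : 'I_4 -> 'rV[K]_4) :
    mgvar K :=
  {| mg_n := 7;
     mg_k := 3;
     mg_wt := fun i j => nth 0%N (nth [::]
       [:: [:: 1; 0; 0]; [:: 1; 0; 0];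
           [:: 0; 1; 0]; [:: 0; 1; 0];
           [:: 0; 0; 1]; [:: 0; 0; 1];
           [:: 3; 2; 2]]%N i) j;
     mg_blocks := [:: [:: fib_l0; fib_l1]; [:: fib_p0; fib_p1];
                      [:: fib_q0; fib_q1]];
     mg_eqs := [:: double_quadrics_eqn F] |}.

Lemma meval_lform (K : fieldType) (n : nat) (a : 'rV[K]_4)
    (P : 'I_4 -> {mpoly K[n]}) (v : 'I_n -> K) :
  (lform a P).@[v] = lform (A := K^o) a (fun j => (P j).@[v]).
Proof.
by rewrite /lform raddf_sum /=; apply: eq_bigr => i _; rewrite mevalZ.
Qed.

Lemma double_octic_eqnE (K : fieldType) (F : 'I_4 -> 'rV[K]_4)
    (v : 'I_(4 + 1) -> K) (x := fun j : 'I_4 => v (lshift 1 j)) :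
  (double_octic_eqn (octic_planes F)).@[v]
  = v (rshift 4 ord0) ^+ 2
    - (\prod_(j < 4) x j) * \prod_(m < 4) lform (A := K^o) (F m) x.
Proof.
rewrite /double_octic_eqn mevalB rmorphXn /= mevalXU; congr (_ - _).
rewrite rmorph_prod /= (@big_split_ord _ _ _ 4 4) /=; congr (_ * _).
  apply: eq_bigr => j _; rewrite meval_lform /octic_planes.
  rewrite (@unsplitK 4 4 (inl j)) /lform (bigD1 j) //= mxE !eqxx mevalXU scale1r.
  rewrite big1 ?addr0 // => i neq_ij.
  by rewrite mxE (negPf neq_ij) andbF scale0r.
apply: eq_bigr => m _; rewrite meval_lform /octic_planes.
rewrite (@unsplitK 4 4 (inr m)) /lform.
by apply: eq_bigr => i _; rewrite mevalXU.
Qed.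

Lemma double_quadrics_eqn_chart (K : fieldType) (F : 'I_4 -> 'rV[K]_4)
    (lam p0 p1 q0 q1 u : K)
    (x := fun j : 'I_4 =>
            nth 0 [:: p0 * q0; p0 * q1; p1 * q0; lam * p1 * q1] j) :
  (double_quadrics_eqn F).@[fun i => nth 0 [:: 1; lam; p0; p1; q0; q1; u] i]
  = u ^+ 2 - lam * \prod_(m < 4) lform (A := K^o) (F m) x.
Proof.
rewrite /double_quadrics_eqn mevalB rmorphXn !mevalM rmorph_prod /= !mevalXU /=.
rewrite mul1r; congr (_ - _ * _); apply: eq_bigr => m _.
rewrite meval_lform /lform; apply: eq_bigr => -[j ltj4] _; apply: congr1.
by case: j ltj4 => [|[|[|[|j]]]] // ltj4;
   rewrite /quadric_coords /x /= !mevalM !mevalXU /= ?mul1r.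
Qed.

(* Main.v *)
Require Import Defs.
From mathcomp Require Import all_boot all_order all_algebra.
From mathcomp Require Import reals.
From mathcomp Require Import complex.
From mathcomp Require Import mpoly ring.

Set Implicit Arguments.
Unset Strict Implicit.
Unset Printing Implicit Defensive.

Import GRing.Theory Num.Theory.
Local Open Scope ring_scope.

(* In the coordinates of the quadric fibration put
     (x, y, z, t) = (l0 p0 q0, l0 p0 q1, l0 p1 q0, l1 p1 q1).
   Then xyzt = l0 l1 (l0 p0 p1 q0 q1)^2, so u |-> l0 p0 p1 q0 q1 u carries the
   second equation to the first.  Conversely p = (x : z), q = (x : y),
   l = (yz : tx) recovers (x, y, z, t) up to the factor xyz.  Both maps are
   given by monomials and are mutually inverse between the loci xyz != 0 and
   l0 p0 p1 q0 q1 != 0.  Such a locus D != 0 is dense in a double cover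
   u^2 = H as soon as HD is not identically zero: join a given point of the
   base to one where HD does not vanish by a line, and work on the double cover
   of this line. *)

(** * Multihomogeneous polynomials and their behaviour under the torus *)

Section Multihomogeneous.
Variables (K : fieldType) (X : mgvar K).
Implicit Types (d : 'I_(mg_k X) -> nat) (p q : {mpoly K[mg_n X]}).
Implicit Types (v w : coords X).

Lemma eq_mghomog d e p : d =1 e -> mghomog d p -> mghomog e p.
Proof. by move=> de hp m /hp dm j; rewrite dm de. Qed.

Lemma mghomogU i : mghomog (mg_wt i) ('X_i : {mpoly K[mg_n X]}).
Proof.
move=> m; rewrite msuppX inE => /eqP -> j.
rewrite (bigD1 i) //= mnmE eqxx mul1n big1 ?addn0 // => k nki.
by rewrite mnmE eq_sym (negPf nki).
Qed.

Lemma mghomog1 : mghomog (fun=> 0%N) (1 : {mpoly K[mg_n X]}).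
Proof.
move=> m; rewrite msupp1 inE => /eqP -> j.
by rewrite big1 // => i _; rewrite mnmE.
Qed.

Lemma mghomogM d e p q :
  mghomog d p -> mghomog e q -> mghomog (fun j => d j + e j)%N (p * q).
Proof.
move=> hp hq m /msuppM_le /allpairsP[[m1 m2] /= [/hp h1 /hq h2 ->]] j.
by rewrite -h1 -h2 -big_split; apply: eq_bigr => i _; rewrite mnmDE mulnDl.
Qed.

Lemma mghomogXn d p n : mghomog d p -> mghomog (fun j => n * d j)%N (p ^+ n).
Proof.
move=> hp; elim: n => [|n IHn]; first by rewrite expr0; exact: mghomog1.
by rewrite exprS; apply: mghomogM.
Qed.

Lemma mghomog_prod n (d : 'I_n -> _) (p : 'I_n -> {mpoly K[mg_n X]}) :
  (forall i, mghomog (d i) (p i)) ->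
  mghomog (fun j => \sum_i d i j)%N (\prod_i p i).
Proof.
move=> hp; elim: n d p hp => [|n IHn] d p hp.
  rewrite big_ord0; by apply: eq_mghomog mghomog1 => j; rewrite big_ord0.
rewrite big_ord_recl.
have IH := IHn _ _ (fun i => hp (lift ord0 i)).
apply: eq_mghomog (mghomogM (hp ord0) IH) => j.
by rewrite big_ord_recl.
Qed.

Lemma mghomogZ d c p : mghomog d p -> mghomog d (c *: p).
Proof. by move=> hp m /msuppZ_le /hp. Qed.

Lemma mghomogD d p q : mghomog d p -> mghomog d q -> mghomog d (p + q).
Proof.
by move=> hp hq m /msuppD_le; rewrite mem_cat => /orP[/hp | /hq].
Qed.

Lemma mghomog_sum d (T : eqType) (r : seq T) (p : T -> {mpoly K[mg_n X]}) :
  (forall i, i \in r -> mghomog d (p i)) -> mghomog d (\sum_(i <- r) p i).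
Proof.
rewrite big_seq => hp; elim/big_ind: _ => // [m|]; last exact: mghomogD.
by rewrite msupp0.
Qed.

(** All monomials of [p] have multidegree [d], so the torus element [s] scales each of them by the
    same character. *)
Lemma meval_mghomog d p v w (s : 'I_(mg_k X) -> K) :
  mghomog d p -> (forall i, w i = (\prod_j s j ^+ mg_wt i j) * v i) ->
  p.@[w] = (\prod_j s j ^+ d j) * p.@[v].
Proof.
move=> hp hw; rewrite !mevalE mulr_sumr [LHS]big_seq_cond [RHS]big_seq_cond.
apply: eq_bigr => m /andP[/hp hm _].
rewrite mulrCA; congr (_ * _).
under eq_bigr => i _ do rewrite hw exprMn.
rewrite big_split /=; congr (_ * _).
under eq_bigr => i _ do rewrite -prodrXl.
rewrite exchange_big; apply: eq_bigr => j _.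
by rewrite -hm -prodrXr; apply: eq_bigr => i _; rewrite -exprM mulnC.
Qed.

End Multihomogeneous.

(** * Morphisms given by multihomogeneous polynomials *)

Section PolynomialMap.
Variables (K : fieldType) (X Y : mgvar K).
Variable P : 'I_(mg_n Y) -> {mpoly K[mg_n X]}.
(* The torus of X acts on the components of P through the homomorphism of tori
   given by the integer matrix M. *)
Variable M : 'I_(mg_k Y) -> 'I_(mg_k X) -> nat.
Hypothesis homP : forall i, mghomog (fun j => \sum_k mg_wt i k * M k j)%N (P i).

Definition poly_map (v : coords X) : coords Y := fun i => (P i).@[v].

Definition pullback (p : {mpoly K[mg_n Y]}) : {mpoly K[mg_n X]} :=
  p \mPo [tuple P i | i < mg_n Y].

Lemma meval_pullback p v : (pullback p).@[v] = p.@[poly_map v].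
Proof.
by rewrite comp_mpoly_meval; apply: meval_eq => i; rewrite tnth_mktuple.
Qed.

(** Substitution turns a monomial [m] of [p] into the product of the [P i ^+ m i], whose
    multidegrees add up to the image of [d] under [M]. *)
Lemma mghomog_pullback d p :
  mghomog d p -> mghomog (fun j => \sum_k d k * M k j)%N (pullback p).
Proof.
move=> hp; rewrite /pullback comp_mpolyE; apply: mghomog_sum => m /hp dm.
apply: mghomogZ; under eq_bigr => i _ do rewrite tnth_mktuple.
have hprod := mghomog_prod (fun i => mghomogXn (n := m i) (@homP i)).
apply: eq_mghomog hprod => j.
under eq_bigr => i _ do rewrite big_distrr.
rewrite exchange_big; apply: eq_bigr => k _ /=.
by rewrite -dm big_distrl; apply: eq_bigr => i _; rewrite mulnA.
Qed.

Lemma same_pt_poly_map v w : same_pt v w -> same_pt (poly_map v) (poly_map w).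
Proof.
(* The witness is the image of [s] under the homomorphism of tori given by [M]. *)
case=> s [s0 hw]; exists (fun k => \prod_j s j ^+ M k j); split=> [k|i].
  by apply/prodf_neq0 => j _; rewrite expf_neq0.
rewrite /poly_map (meval_mghomog (@homP i) hw); congr (_ * _).
under [RHS]eq_bigr => k _ do rewrite -prodrXl.
rewrite exchange_big; apply: eq_bigr => j _ /=.
by rewrite -prodrXr; apply: eq_bigr => k _; rewrite mulnC exprM.
Qed.

Variables (dD : 'I_(mg_k X) -> nat) (D : {mpoly K[mg_n X]}).
Hypothesis homD : mghomog dD D.
Variable V : coords Y -> Prop.
Let U (v : coords X) : Prop := mem_pt v /\ D.@[v] != 0.
Hypothesis UV : forall v, U v -> V (poly_map v).
Hypothesis Vmem : forall w, V w -> mem_pt w.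

(** If [g] cuts out a neighbourhood inside [W], its pullback does so inside the preimage; the extra
    factor [D] keeps this neighbourhood inside [U]. *)
Lemma zopen_poly_map (W : coords Y -> Prop) :
  zopen W -> zopen (fun v => U v /\ W (poly_map v)).
Proof.
move=> oW v [Uv Wv]; split; first by case: Uv.
have [_ [d [g [hg gv gW]]]] := oW _ Wv.
exists (fun j => (\sum_k d k * M k j) + dD j)%N, (pullback g * D); split.
- exact/mghomogM/homD/mghomog_pullback.
- by rewrite mevalM mulf_neq0 ?meval_pullback //; case: Uv.
move=> w mw; rewrite mevalM mulf_eq0 negb_or meval_pullback => /andP[gw Dw].
have Uw : U w by [].
by split=> //; apply: gW => //; apply/Vmem/UV.
Qed.

(** A local fraction [a / b] pulls back to the fraction of the pullbacks, which again share one
    multidegree. *)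
Lemma morphism_poly_map : morphism U V poly_map.
Proof.
split=> [//| v w _ _ | W oW | W f oW _ rf v [Uv Wv]].
- exact: same_pt_poly_map.
- exact: zopen_poly_map.
have [W' [oW' Wv' WW' [d [a [b [ha hb fab]]]]]] := rf _ Wv.
exists (fun v => U v /\ W' (poly_map v)); split=> //.
- exact: zopen_poly_map.
- by move=> w [Uw /WW'].
exists (fun j => \sum_k d k * M k j)%N, (pullback a), (pullback b).
split; try exact: mghomog_pullback.
by move=> w [_ /fab]; rewrite !meval_pullback.
Qed.

End PolynomialMap.

(** * Basic open sets and their density in a double cover *)

Lemma zopen_basic (K : fieldType) (X : mgvar K) d (D : {mpoly K[mg_n X]}) :
  mghomog d D -> zopen (fun v : coords X => mem_pt v /\ D.@[v] != 0).
Proof. by move=> hD v [mv Dv]; split=> //; exists d, D. Qed.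

(* Split [g] into its even part [A] and odd part [B] in [u], both evaluated on
   the curve: at a point where [Q] does not vanish, [A + B u] and [A - B u]
   cannot both be zero unless [A] and [B] are. *)
Lemma double_cover_curve (K : numClosedFieldType) (Q D : {poly K})
    (g : {poly {poly K}}) (s0 u0 : K) :
  Q != 0 -> D != 0 -> u0 ^+ 2 = Q.[s0] -> g.[u0%:P].[s0] != 0 ->
  exists s u, [/\ u ^+ 2 = Q.[s], D.[s] != 0 & g.[u%:P].[s] != 0].
Proof.
move=> Q0 D0 e0 g0.
pose A := (even_poly g).[Q]; pose B := (odd_poly g).[Q].
(* The value at [s] depends on [p] only through [p.[s]], so [Q] may stand for the square of [u] on
   the curve. *)
have evC (h : {poly {poly K}}) (p q : {poly K}) s :
    p.[s] = q.[s] -> h.[p].[s] = h.[q].[s].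
  move=> pq; rewrite !(horner_coef h) -!(horner_evalE s) !rmorph_sum.
  by apply: eq_bigr => i _; rewrite !rmorphM !rmorphXn /= !horner_evalE pq.
have gE s u : u ^+ 2 = Q.[s] -> g.[u%:P].[s] = A.[s] + B.[s] * u.
  move=> uQ; rewrite -[g in LHS]poly_even_odd hornerD hornerM !horner_comp.
  rewrite hornerXn hornerX -rmorphXn /= uQ hornerD hornerM hornerC.
  by congr (_ + _ * _); apply: evC; rewrite hornerC.
(* If [A] is zero, [g] equals [B u] on the curve, and [B] is nonzero because of the given point.
   Choosing [s] off the zeros of [Q], [D] and [B] makes both factors nonzero. *)
have [AB0|] := altP (A =P 0).
  have B0 : B != 0.
    by apply: contraNneq g0 => B0; rewrite gE // AB0 B0 !horner0 mul0r addr0.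
  have /closed_nonrootP[s] : Q * D * B != 0 by rewrite !mulf_neq0.
  rewrite rootE !hornerM !mulf_eq0 !negb_or => /andP[/andP[Qs Ds] Bs].
  exists s, (sqrtC Q.[s]); rewrite sqrtCK; split=> //.
  by rewrite gE ?sqrtCK // AB0 horner0 add0r mulf_neq0 // sqrtC_eq0.
(* If [A] is nonzero, choose [s] off the zeros of [D] and [A]. Were [g] zero at both square roots of
   [Q.[s]], adding the two values would give twice [A.[s]] equal to zero, impossible in
   characteristic 0. *)
move=> A0; have /closed_nonrootP[s] : D * A != 0 by rewrite mulf_neq0.
rewrite rootE hornerM mulf_eq0 negb_or => /andP[Ds As].
have [gs0|gs] := altP (g.[(sqrtC Q.[s])%:P].[s] =P 0); last first.
  by exists s, (sqrtC Q.[s]); rewrite sqrtCK.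
exists s, (- sqrtC Q.[s]); rewrite sqrrN sqrtCK; split=> //.
apply: contraNneq As; move: gs0; rewrite !gE ?sqrrN ?sqrtCK // mulrN.
set b := _ * _ => eq1 eq2.
have : A.[s] *+ 2 == 0.
  have -> : A.[s] *+ 2 = (A.[s] + b) + (A.[s] - b) by ring.
  by rewrite eq1 eq2 addr0.
by rewrite mulrn_eq0.
Qed.

(** Independence of a variable is phrased through values, the form in which it is applied to points
    of a line. *)
Definition free_of (K : fieldType) n (i0 : 'I_n) (p : {mpoly K[n]}) : Prop :=
  forall v w : 'I_n -> K, (forall i, i != i0 -> v i = w i) -> p.@[v] = p.@[w].

Lemma free_of_mul (K : fieldType) n (i0 : 'I_n) (p q : {mpoly K[n]}) :
  free_of i0 p -> free_of i0 q -> free_of i0 (p * q).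
Proof. by move=> fp fq v w vw; rewrite !mevalM (fp v w) // (fq v w). Qed.

Lemma free_ofX (K : fieldType) n (i0 i : 'I_n) :
  i != i0 -> free_of i0 ('X_i : {mpoly K[n]}).
Proof. by move=> ni v w vw; rewrite !mevalXU vw. Qed.

Lemma free_of_lforms (K : fieldType) m n (i0 : 'I_n) (a : 'I_m -> 'rV[K]_4)
    (P : 'I_4 -> {mpoly K[n]}) :
  (forall j, free_of i0 (P j)) -> free_of i0 (\prod_i lform (a i) P).
Proof.
move=> fP v w vw; rewrite !rmorph_prod; apply: eq_bigr => i _ /=.
rewrite !meval_lform; apply: eq_bigr => j _.
by rewrite (fP j v w).
Qed.

Section Density.
Variables (K : numClosedFieldType) (X : mgvar K) (i0 : 'I_(mg_n X)).
Variables H D : {mpoly K[mg_n X]}.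
Hypothesis eqsX : mg_eqs X = [:: 'X_i0 ^+ 2 - H].

(** The line runs from [v] at [s = 0] to [w] at [s = 1] in the base coordinates; the coordinate [i0]
    of the double cover stays free. *)
Let line (v w : coords X) (s u : K) : coords X :=
  fun i => if i == i0 then u else (1 - s) * v i + s * w i.

(** Restriction to this family of points: the outer variable is [u], the inner one is the parameter
    [s]. *)
Let restr (v w : coords X) : {mpoly K[mg_n X]} -> {poly {poly K}} :=
  mmap (fun c => c%:P%:P)
    (fun i => if i == i0 then 'X
              else ((1 - 'X) * (v i)%:P + 'X * (w i)%:P)%:P).

Let horner_restr v w p s u :
  (restr v w p).[u%:P].[s] = p.@[line v w s u].
Proof.
rewrite /restr /mmap mevalE -(horner_evalE u%:P) -(horner_evalE s) !rmorph_sum.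
apply: eq_bigr => m _; rewrite !rmorphM /= !horner_evalE !hornerC.
congr (_ * _).
rewrite /mmap1 -(horner_evalE u%:P) -(horner_evalE s) !rmorph_prod.
apply: eq_bigr => i _; rewrite !rmorphXn /= !horner_evalE /line; congr (_ ^+ _).
by case: eqP => _; rewrite ?hornerX hornerC // !hornerE.
Qed.

Lemma double_cover_dense :
  free_of i0 H -> free_of i0 D ->
  (forall v : coords X,
     D.@[v] != 0 -> all (has (fun i => v i != 0)) (mg_blocks X)) ->
  (exists w, H.@[w] != 0 /\ D.@[w] != 0) ->
  zdense (fun v : coords X => mem_pt v /\ D.@[v] != 0).
Proof.
move=> freeH freeD blocksX [w [Hw Dw]] W oW [v Wv].
have [mv [d [g [hg gv gW]]]] := oW _ Wv.
have memE (x : coords X) : D.@[x] != 0 -> x i0 ^+ 2 = H.@[x] -> mem_pt x.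
  move=> Dx Hx; rewrite /mem_pt blocksX // eqsX /= andbT.
  by rewrite mevalB rmorphXn /= mevalXU Hx subrr.
have Hv : v i0 ^+ 2 = H.@[v].
  apply/eqP; rewrite -subr_eq0; case/andP: mv => _; rewrite eqsX /= andbT.
  by rewrite mevalB rmorphXn /= mevalXU.
(* For [p] free of [i0] the restriction is constant in [u], so [u] and [u'] may differ. *)
have lineE p s u u' :
    free_of i0 p -> (restr v w p).[u'%:P].[s] = p.@[line v w s u].
  move=> freep; rewrite horner_restr; apply: freep => i ni0.
  by rewrite /line (negPf ni0).
have line0 u i : i != i0 -> line v w 0 u i = v i.
  by move=> ni0; rewrite /line (negPf ni0) subr0 mul1r mul0r addr0.
have line1 u i : i != i0 -> line v w 1 u i = w i.
  by move=> ni0; rewrite /line (negPf ni0) subrr mul1r mul0r add0r.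
(* The restriction is not the zero polynomial, since at [s = 1] it takes the value of [p] at [w]. *)
have restr_neq0 p : free_of i0 p -> p.@[w] != 0 -> (restr v w p).[0%:P] != 0.
  move=> freep; apply: contraNneq => p0.
  by rewrite -(freep _ _ (line1 0)) -(lineE p 1 0 0 freep) p0 horner0.
have Q0 := restr_neq0 _ freeH Hw; have D0 := restr_neq0 _ freeD Dw.
(* The curve passes through [v] at [s = 0], [u = v i0], where [g] does not vanish; this is the
   starting point that the curve lemma requires. *)
have [||s [u [uQ Ds gs]]] :=
  double_cover_curve (g := restr v w g) (s0 := 0) (u0 := v i0) Q0 D0.
- by rewrite (lineE H 0 0 0 freeH) (freeH _ _ (line0 0)).
- rewrite horner_restr (meval_eq _ (_ : _ =1 v)) // => i.
  by have [->|/line0->//] := eqVneq i i0; rewrite /line eqxx.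
rewrite (lineE H s u 0 freeH) in uQ; rewrite (lineE D s u 0 freeD) in Ds.
rewrite horner_restr in gs.
have mx : mem_pt (line v w s u) by apply: memE => //; rewrite {1}/line eqxx.
by exists (line v w s u); split; [apply: gW|].
Qed.

End Density.

(** * Values of linear forms *)

Lemma lform_scale (K : fieldType) (a : 'rV[K]_4) c (x y : 'I_4 -> K) :
  (forall j, y j = c * x j) -> lform (A := K^o) a y = c * lform (A := K^o) a x.
Proof.
move=> hy; rewrite /lform mulr_sumr; apply: eq_bigr => j _.
by rewrite hy /GRing.scale /= mulrCA.
Qed.

(** On the twisted cubic [(1, s, s^2, s^3)] a nonzero form becomes a nonzero polynomial in [s], so
    any nonroot of the product of these polynomials gives the point. *)
Lemma lforms_neq0 (K : numClosedFieldType) n (l : 'I_n -> 'rV[K]_4) :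
  (forall i, l i != 0) ->
  exists x : 'I_4 -> K, forall i, lform (A := K^o) (l i) x != 0.
Proof.
move=> l0; have /closed_nonrootP[s] : \prod_i rVpoly (l i) != 0.
  apply/prodf_neq0 => i _; apply: contraNneq (l0 i) => li0.
  by rewrite -(rVpolyK (l i)) li0 linear0.
rewrite rootE horner_prod => /prodf_neq0 hs.
exists (fun j => s ^+ j) => i; have := hs i isT.
rewrite horner_poly (eq_bigr (fun j => l i 0 j *: (s ^+ j : K^o))) // => j _.
by rewrite valK.
Qed.

Lemma ord4P (i : 'I_4) :
  i \in [:: @Ordinal 4 0 isT; @Ordinal 4 1 isT;
            @Ordinal 4 2 isT; @Ordinal 4 3 isT].
Proof. by case: i => [[|[|[|[|]]]] ?]; rewrite // !inE -!val_eqE. Qed.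

(** * The two monomial maps and their multidegrees *)

Section BirationalMaps.
Variables (K : numClosedFieldType) (F : 'I_4 -> 'rV[K]_4).

Local Notation X := (double_octic (octic_planes F)).
Local Notation Y := (double_quadrics_fibration F).
Local Notation oct_x := (lshift 1 (@Ordinal 4 0 isT)).
Local Notation oct_y := (lshift 1 (@Ordinal 4 1 isT)).
Local Notation oct_z := (lshift 1 (@Ordinal 4 2 isT)).
Local Notation oct_t := (lshift 1 (@Ordinal 4 3 isT)).
Local Notation oct_u := (rshift 4 (@ord0 0)).

(** The factor of [u] is forced: with [c = xyz] the first six components give back [c (x, y, z, t)],
    so [u] must return as [c^4 u], while [l0 p0 p1 q0 q1] equals [c^2]. *)
Definition octic_to_quadrics (i : 'I_7) : {mpoly K[4 + 1]} :=
  nth 0 [:: 'X_oct_y * 'X_oct_z; 'X_oct_t * 'X_oct_x; 'X_oct_x; 'X_oct_z;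
            'X_oct_x; 'X_oct_y;
            ('X_oct_x * 'X_oct_y * 'X_oct_z) ^+ 2 * 'X_oct_u] i.

Definition quadrics_to_octic (i : 'I_(4 + 1)) : {mpoly K[7]} :=
  nth 0 [:: 'X_fib_l0 * 'X_fib_p0 * 'X_fib_q0;
            'X_fib_l0 * 'X_fib_p0 * 'X_fib_q1;
            'X_fib_l0 * 'X_fib_p1 * 'X_fib_q0;
            'X_fib_l1 * 'X_fib_p1 * 'X_fib_q1;
            'X_fib_l0 * 'X_fib_p0 * 'X_fib_p1 * 'X_fib_q0 * 'X_fib_q1
              * 'X_fib_u] i.

Definition oct_den : {mpoly K[4 + 1]} := 'X_oct_x * 'X_oct_y * 'X_oct_z.

Definition fib_den : {mpoly K[7]} :=
  'X_fib_l0 * 'X_fib_p0 * 'X_fib_p1 * 'X_fib_q0 * 'X_fib_q1.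

Lemma ord5P (i : 'I_(4 + 1)) : i \in [:: oct_x; oct_y; oct_z; oct_t; oct_u].
Proof. by case: i => [[|[|[|[|[|]]]]] ?]; rewrite // !inE -!val_eqE. Qed.

Lemma ord7P (i : 'I_7) :
  i \in [:: fib_l0; fib_l1; fib_p0; fib_p1; fib_q0; fib_q1; fib_u].
Proof. by case: i => [[|[|[|[|[|[|[|]]]]]]] ?]; rewrite // !inE -!val_eqE. Qed.

Ltac mghom :=
  repeat first [ apply: mghomogXn | apply: mghomogM | apply: mghomogU ].

(** The pairs [l], [p], [q] have degrees 2, 1, 1, and the last component has degree
    [3*2 + 2*1 + 2*1 = 10 = 6 + 4]. *)
Lemma mghomog_octic_to_quadrics i :
  mghomog (X := X)
    (fun j => \sum_(k < 3) mg_wt (m := Y) i k * nth 0 [:: 2; 1; 1] k)%N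
    (octic_to_quadrics i).
Proof.
have := ord7P i; rewrite !inE; do !(case/predU1P=> [->|]); last move/eqP->;
  (apply: eq_mghomog; last by rewrite /octic_to_quadrics /=; mghom);
  by move=> j; rewrite !big_ord_recl big_ord0.
Qed.

(** The first four components have multidegree [(1, 1, 1)], and the last has
    [(1, 2, 2) + (3, 2, 2) = (4, 4, 4)], matching the weight 4 of [u]. *)
Lemma mghomog_quadrics_to_octic i :
  mghomog (X := Y)
    (fun j => \sum_(k < 1) mg_wt (m := X) i k * 1)%N (quadrics_to_octic i).
Proof.
have := ord5P i; rewrite !inE; do !(case/predU1P=> [->|]); last move/eqP->;
  (apply: (@eq_mghomog K Y); last by rewrite /quadrics_to_octic /=; mghom);
  by rewrite /= !big_ord_recl big_ord0; case=> [[|[|[|]]]].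
Qed.

Lemma mghomog_oct_den : mghomog (X := X) (fun=> 3) oct_den.
Proof. apply: (@eq_mghomog K X); last by mghom. by []. Qed.

Lemma mghomog_fib_den :
  mghomog (X := Y) (fun j => nth 0 [:: 1; 2; 2] j) fib_den.
Proof.
apply: (@eq_mghomog K Y); last by mghom.
by case=> [[|[|[|]]]].
Qed.

(** * Branch polynomials and denominators under the two maps *)

Definition oct_rhs : {mpoly K[4 + 1]} :=
  \prod_(i < 8) lform (octic_planes F i) (fun j => 'X_(lshift 1 j)).

Definition fib_rhs : {mpoly K[7]} :=
  'X_fib_l0 * 'X_fib_l1 * \prod_(m < 4) lform (F m) (@quadric_coords K).

Lemma meval_oct_rhs (v : coords X) :
  oct_rhs.@[v] = v oct_x * v oct_y * v oct_z * v oct_t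
    * \prod_(m < 4) lform (A := K^o) (F m) (fun j => v (lshift 1 j)).
Proof.
have := double_octic_eqnE F v.
rewrite /double_octic_eqn mevalB rmorphXn /= mevalXU.
move=> /addrI/oppr_inj; rewrite /oct_rhs => ->; congr (_ * _).
rewrite !big_ord_recl big_ord0 mulr1 !mulrA.
by congr (v _ * v _ * v _ * v _); apply: val_inj.
Qed.

Lemma meval_fib_rhs (w : coords Y) :
  fib_rhs.@[w] = w fib_l0 * w fib_l1
    * \prod_(m < 4) lform (A := K^o) (F m) (fun j => (quadric_coords K j).@[w]).
Proof.
rewrite /fib_rhs !mevalM rmorph_prod /= !mevalXU; congr (_ * _).
by apply: eq_bigr => m _; rewrite meval_lform.
Qed.

Let phi : coords X -> coords Y := @poly_map K X Y octic_to_quadrics.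
Let psi : coords Y -> coords X := @poly_map K Y X quadrics_to_octic.

Let phiE v : (phi v fib_l0 = v oct_y * v oct_z)
  * (phi v fib_l1 = v oct_t * v oct_x)
  * (phi v fib_p0 = v oct_x) * (phi v fib_p1 = v oct_z)
  * (phi v fib_q0 = v oct_x) * (phi v fib_q1 = v oct_y)
  * (phi v fib_u = (v oct_x * v oct_y * v oct_z) ^+ 2 * v oct_u).
Proof.
by rewrite /phi /poly_map /octic_to_quadrics /= !mevalM !mevalXU expr2.
Qed.

Let psiE w : (psi w oct_x = w fib_l0 * w fib_p0 * w fib_q0)
  * (psi w oct_y = w fib_l0 * w fib_p0 * w fib_q1)
  * (psi w oct_z = w fib_l0 * w fib_p1 * w fib_q0)
  * (psi w oct_t = w fib_l1 * w fib_p1 * w fib_q1)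
  * (psi w oct_u
     = w fib_l0 * w fib_p0 * w fib_p1 * w fib_q0 * w fib_q1 * w fib_u).
Proof. by rewrite /psi /poly_map /quadrics_to_octic /= !mevalM !mevalXU. Qed.

Lemma meval_oct_den v : oct_den.@[v] = v oct_x * v oct_y * v oct_z.
Proof. by rewrite /oct_den !mevalM !mevalXU. Qed.

Lemma meval_fib_den w :
  fib_den.@[w] = w fib_l0 * w fib_p0 * w fib_p1 * w fib_q0 * w fib_q1.
Proof. by rewrite /fib_den !mevalM !mevalXU. Qed.

(** With [c = xyz] the quadric coordinates of the image are [c (x, y, z, t)], so the four forms
    contribute [c^4], while [l0 l1] becomes [xyzt]. *)
Lemma fib_rhs_phi v : fib_rhs.@[phi v] = oct_den.@[v] ^+ 4 * oct_rhs.@[v].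
Proof.
rewrite meval_fib_rhs meval_oct_rhs meval_oct_den !phiE.
set c := _ * _ * v oct_z.
have lformE m : lform (A := K^o) (F m) (fun j => (quadric_coords K j).@[phi v])
    = c * lform (A := K^o) (F m) (fun j => v (lshift 1 j)).
  apply: lform_scale => j; have := ord4P j.
  rewrite !inE; do !(case/predU1P=> [->|]); last move/eqP->;
  by rewrite /quadric_coords /= !mevalM !mevalXU !phiE /c; ring.
under eq_bigr => m _ do rewrite lformE.
by rewrite big_split prodr_const card_ord /= /c; ring.
Qed.

(** The forms are evaluated at the same four coordinates on both sides, so only the factor [xyzt]
    has to be compared. *)
Lemma oct_rhs_psi w : oct_rhs.@[psi w] = fib_den.@[w] ^+ 2 * fib_rhs.@[w].
Proof.
rewrite meval_fib_rhs meval_oct_rhs meval_fib_den !psiE.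
set P := \prod_(_ < _) _; set P' := \prod_(_ < _) _.
have -> : P = P'.
  apply: eq_bigr => m _; apply: eq_bigr => j _; congr (_ *: _).
  by case: j => [[|[|[|[|]]]] ?].
ring.
Qed.

Let U (v : coords X) : Prop := mem_pt v /\ oct_den.@[v] != 0.
Let V (w : coords Y) : Prop := mem_pt w /\ fib_den.@[w] != 0.

Lemma oct_blocks (v : coords X) :
  oct_den.@[v] != 0 -> all (has (fun i => v i != 0)) (mg_blocks X).
Proof.
rewrite meval_oct_den !mulf_eq0 !negb_or => /andP[/andP[x0 _] _].
by rewrite /= andbT; apply/hasP; exists oct_x; rewrite ?mem_enum.
Qed.

Lemma fib_blocks (w : coords Y) :
  fib_den.@[w] != 0 -> all (has (fun i => w i != 0)) (mg_blocks Y).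
Proof.
rewrite meval_fib_den !mulf_eq0 !negb_or.
by case/andP=> [/andP[/andP[/andP[l0 p0] _] q0] _]; rewrite /= l0 p0 q0.
Qed.

Lemma mem_oct (v : coords X) :
  oct_den.@[v] != 0 -> mem_pt v = (v oct_u ^+ 2 == oct_rhs.@[v]).
Proof.
move=> v0; rewrite /mem_pt oct_blocks //= andbT.
by rewrite mevalB rmorphXn /= mevalXU subr_eq0.
Qed.

Lemma mem_fib (w : coords Y) :
  fib_den.@[w] != 0 -> mem_pt w = (w fib_u ^+ 2 == fib_rhs.@[w]).
Proof.
move=> w0; rewrite /mem_pt fib_blocks //= andbT.
by rewrite mevalB rmorphXn /= mevalXU subr_eq0.
Qed.

Lemma fib_den_phi v : fib_den.@[phi v] = oct_den.@[v] ^+ 2.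
Proof. by rewrite meval_fib_den meval_oct_den !phiE; ring. Qed.

Lemma oct_den_psi w :
  oct_den.@[psi w] = w fib_l0 ^+ 2 * w fib_p0 * w fib_q0 * fib_den.@[w].
Proof. by rewrite meval_fib_den meval_oct_den !psiE; ring. Qed.

Lemma phi_sub v : U v -> V (phi v).
Proof.
case=> mv v0.
have f0 : fib_den.@[phi v] != 0 by rewrite fib_den_phi expf_neq0.
split=> //; move: mv; rewrite mem_fib // mem_oct // fib_rhs_phi => /eqP <-.
by rewrite !phiE meval_oct_den; apply/eqP; ring.
Qed.

Lemma psi_sub w : V w -> U (psi w).
Proof.
case=> mw w0.
have f0 : oct_den.@[psi w] != 0.
  rewrite oct_den_psi mulf_neq0 //; move: w0.
  rewrite meval_fib_den !mulf_eq0 !negb_or.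
  by case/andP=> [/andP[/andP[/andP[-> ->] _] -> _]].
split=> //; move: mw; rewrite mem_fib // mem_oct // oct_rhs_psi => /eqP <-.
by rewrite !psiE meval_fib_den; apply/eqP; ring.
Qed.

Lemma psi_phi v : U v -> same_pt v (psi (phi v)).
Proof.
(* The composite multiplies [x, y, z, t] by [xyz] and [u] by its fourth power. *)
case=> _ v0; exists (fun=> oct_den.@[v]); split=> // i.
rewrite /= big_ord_recl big_ord0 mulr1 meval_oct_den; have := ord5P i.
by rewrite !inE; do !(case/predU1P=> [->|]); last move/eqP->;
  rewrite psiE !phiE /=; ring.
Qed.

Lemma phi_psi w : V w -> same_pt w (phi (psi w)).
Proof.
case=> _ w0.
(* The composite scales [l] by [yz / l0 = tx / l1], [p] by [l0 q0] and [q] by [l0 p0]; then [u] is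
   scaled with exponents 3, 2, 2. *)
exists (fun j : 'I_3 => nth 0
  [:: fib_den.@[w]; w fib_l0 * w fib_q0; w fib_l0 * w fib_p0] j).
move: (w0); rewrite !meval_fib_den !mulf_eq0 !negb_or.
case/andP=> [/andP[/andP[/andP[l0 p0] p1] q0] q1]; split.
  by case=> [[|[|[|]]]] //= _; rewrite ?mulf_neq0.
move=> i; rewrite /= !big_ord_recl big_ord0 mulr1; have := ord7P i.
by rewrite !inE; do !(case/predU1P=> [->|]); last move/eqP->;
  rewrite phiE !psiE /=; ring.
Qed.

(** * Density of the two loci and the birational equivalence *)

Lemma oct_dense :
  (exists v, oct_rhs.@[v] != 0 /\ oct_den.@[v] != 0) -> zdense U.
Proof.
apply: (@double_cover_dense K X oct_u oct_rhs) => //.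
- by apply: free_of_lforms => j; apply: free_ofX; rewrite -val_eqE /= ltn_eqF.
- by do !apply: free_of_mul; apply: free_ofX.
- exact: oct_blocks.
Qed.

Lemma fib_dense :
  (exists w, fib_rhs.@[w] != 0 /\ fib_den.@[w] != 0) -> zdense V.
Proof.
apply: (@double_cover_dense K Y fib_u fib_rhs) => //.
- do !apply: free_of_mul; try exact: free_ofX.
  apply: free_of_lforms => j; have := ord4P j; rewrite !inE.
  by do !(case/predU1P=> [->|]); last move/eqP->;
     do !apply: free_of_mul; apply: free_ofX.
- by do !apply: free_of_mul; apply: free_ofX.
- exact: fib_blocks.
Qed.

Lemma octic_generic :
  (forall i, octic_planes F i != 0) ->
  exists v, oct_rhs.@[v] != 0 /\ oct_den.@[v] != 0.
Proof.
move=> /lforms_neq0[x hx].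
(* The coordinate [u] is set to 0 arbitrarily: [v] need not lie on the double octic, as only
   polynomials free of [u] are evaluated there. *)
pose v i := if split (i : 'I_(4 + 1)) is inl j then x j else 0.
have rhs0 : oct_rhs.@[v] != 0.
  rewrite /oct_rhs rmorph_prod; apply/prodf_neq0 => i _ /=.
  rewrite meval_lform; move: (hx i); congr (_ != 0); apply: eq_bigr => j _.
  by rewrite mevalXU /v (unsplitK (inl j)).
(* The denominator [xyz] divides the product of the eight forms, so it is nonzero as well. *)
exists v; split=> //; move: rhs0; rewrite meval_oct_rhs meval_oct_den.
by rewrite mulf_eq0 negb_or => /andP[+ _]; rewrite mulf_eq0 negb_or => /andP[].
Qed.

Lemma double_octic_birational :
  (forall i, octic_planes F i != 0) -> birational X Y.
Proof.
move=> /octic_generic[v [vr vd]]; exists U, V; split.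
- exact: zopen_basic mghomog_oct_den.
- by apply: oct_dense; exists v.
- exact: zopen_basic mghomog_fib_den.
(* The formulas for the images under [phi] carry the nonvanishing over from the octic side. *)
- apply: fib_dense; exists (phi v).
  by rewrite fib_rhs_phi fib_den_phi mulf_neq0 ?expf_neq0.
exists phi, psi; split.
- apply: (@morphism_poly_map K X Y _ (fun k _ => nth 0 [:: 2; 1; 1] k)%N
    mghomog_octic_to_quadrics _ _ mghomog_oct_den _ phi_sub).
  by move=> w [].
- apply: (@morphism_poly_map K Y X _ (fun _ _ => 1)%N
    mghomog_quadrics_to_octic _ _ mghomog_fib_den _ psi_sub).
  by move=> v' [].
- exact: psi_phi.
- exact: phi_psi.
Qed.

End BirationalMaps.

Theorem theorem4p3 (R : realType) (F : 'I_4 -> 'rV[R[i]]_4)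
    (hF : octic_arrangement (octic_planes F)) :
  birational (double_octic (octic_planes F)) (double_quadrics_fibration F).
Proof. by case: hF => l0 _ _ _; exact: (@double_octic_birational R[i] F). Qed.
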